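(* Let $G=(V,E)$ be a resistance nonnegative graph, let $x\in V$, and let $0<c<\infty$ be edge weights on $G$ with $p_v(c)\ge 0$ for all $v\in V$. Then the circle inversion $\operatorname{cinv}_x(G,c)$ is resistance nonnegative. Furthermore, if $p_x(c)>0$ and $x$ is adjacent in $G$ to all other vertices, then $\operatorname{cinv}_x(G,c)$ is resistance positive.
   Context: All graphs $G=(V,E)$ are finite, simple (no multi-edges), loopless and connected. Resistance curvature: a spanning tree of $G$ is a maximal acyclic subset of edges $T\subseteq E$. For edge weights $c=(c_e)_{e\in E}$ with $0<c_e<\infty$, the relative resistance of $e\in E$ is $r_e(c)=\frac{\sum_{T\ni e}\prod_{t\in T}c_t}{\sum_{T}\prod_{t\in T}c_t}$, with sums over spanning trees $T$, and the resistance curvature of $v\in V$ is $p_v(c)=1-\frac12\sum_{uv\in E}r_{uv}(c)$ (sum over edges incident to $v$). $G$ is resistance nonnegative (RN) if there exist weights $c$ with $p_v(c)\ge 0$ for all $v\in V$, and resistance positive (RP) if there exist weights $c$ with $p_v(c)>0$ for all $v\in V$. Circle inversion: let $G$ be an RN graph with vertex $x\in V$ and weights $c$ such that $p_v(c)\geq 0$ for all $v$. The circle inversion over $x$, written $\operatorname{cinv}_x(G,c)$, is the graph obtained from $G$ by removing $x$ and adding a new vertex $\hat{x}$ with edges $\{\hat{x}y\mid y\in V\setminus\{x\},\ p_y(c)>0\text{ in }G\}$. *)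

(* Defs.v *)
From HB Require Import structures.
From mathcomp Require Import all_boot all_order all_algebra.
From mathcomp Require Import boolp reals.

Set Implicit Arguments.
Unset Strict Implicit.
Unset Printing Implicit Defensive.

Import Order.TTheory GRing.Theory Num.Theory.
Local Open Scope ring_scope.

Record sgraph := SGraph {
  vertex :> finType;
  adj : rel vertex;
  adj_sym : symmetric adj;
  adj_irrefl : irreflexive adj
}.

Definition connected_graph (G : sgraph) : Prop :=
  (0 < #|G|)%N /\ forall u v : G, connect (@adj G) u v.

Definition edges (G : sgraph) : {set {set G}} :=
  [set [set p.1; p.2] | p : G * G & adj p.1 p.2].

(* The cycles of an edge set are the sequences of pairwise distinct vertices of
   length at least 3; [ucycle] also accepts the shorter, degenerate ones. *)
Definition acyclic (G : sgraph) (T : {set {set G}}) : bool :=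
  `[< forall s : seq G,
        ucycle (fun u v : G => [set u; v] \in T) s -> (size s <= 2)%N >].

Definition spanning_tree (G : sgraph) (T : {set {set G}}) : bool :=
  maxset (fun S : {set {set G}} => (S \subset edges G) && acyclic S) T.

(* Weights are functions on all vertex sets; only their values on [edges G]
   are constrained or used. *)
Definition edge_weights (R : realType) (G : sgraph) (c : {set G} -> R) : Prop :=
  forall e : {set G}, e \in edges G -> 0 < c e.

Definition resistance (R : realType) (G : sgraph) (c : {set G} -> R)
    (e : {set G}) : R :=
  (\sum_(T : {set {set G}} | spanning_tree T && (e \in T)) \prod_(t in T) c t)
  / (\sum_(T : {set {set G}} | spanning_tree T) \prod_(t in T) c t).

Definition curvature (R : realType) (G : sgraph) (c : {set G} -> R) (v : G) : R :=
  1 - 2^-1 * \sum_(u : G | adj u v) resistance c [set u; v].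

Definition resistance_nonnegative (R : realType) (G : sgraph) : Prop :=
  connected_graph G /\
  exists c : {set G} -> R, edge_weights c /\ forall v : G, 0 <= curvature c v.

Definition resistance_positive (R : realType) (G : sgraph) : Prop :=
  connected_graph G /\
  exists c : {set G} -> R, edge_weights c /\ forall v : G, 0 < curvature c v.

Section CircleInversion.
Variables (R : realType) (G : sgraph) (x : G) (c : {set G} -> R).

(* [None] is the new vertex. *)
Definition cinv_vertex : finType := option {y : G | y != x}.

Definition cinv_adj : rel cinv_vertex := fun a b =>
  match a, b with
  | Some u, Some v => adj (val u) (val v)
  | None, Some y | Some y, None => 0 < curvature c (val y)
  | None, None => false
  end.

Lemma cinv_adj_sym : symmetric cinv_adj.
Proof. by case=> [u|] [v|] //=; rewrite adj_sym. Qed.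

Lemma cinv_adj_irrefl : irreflexive cinv_adj.
Proof. by case=> [u|] //=; rewrite adj_irrefl. Qed.

Definition cinv : sgraph := SGraph cinv_adj_sym cinv_adj_irrefl.

End CircleInversion.

(* Main.v *)
Require Import Defs.
From mathcomp Require Import all_boot all_order all_algebra.
From mathcomp Require Import boolp reals ring lra.

(* Let [g] be the Green function of the weighted Laplacian grounded at [x], so
   that the effective resistance between [s] and [t] is
   [g s s + g t t - 2 * g s t].  Counting spanning trees and two-component
   spanning forests (Kirchhoff) identifies the relative resistance of an edge
   [st] with [c st] times this quantity; hence [u |-> g u u] has Laplacian
   [2 * p u] at every [u != x].  On the circle inversion put the weights
   [c uv * g u u * g v v] on old edges and [2 * p u * g u u] on new ones: its
   Green function grounded at the new vertex is [g u v / (g u u * g v v)], so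
   [r uv] is unchanged and the new edge at [u] has relative resistance
   [2 * p u].  The new curvatures are therefore [r xu / 2] at the neighbours
   [u] of [x], [0] at the other old vertices, and [p x] at the new vertex.
   For connectedness, pair [u |-> g u u] in the Dirichlet form with the
   indicator of the vertices not joined to the new vertex: [p] vanishes on that
   set, so no edge can leave it. *)

Import Order.TTheory GRing.Theory Num.Theory.
Local Open Scope ring_scope.

Set Implicit Arguments.
Unset Strict Implicit.
Unset Printing Implicit Defensive.

(** * Acyclic edge sets and spanning trees *)

Lemma set2_eq (V : finType) (u v a b : V) :
  [set u; v] = [set a; b] -> (u = a /\ v = b) \/ (u = b /\ v = a).
Proof.
move=> E.
have := set21 u v; have := set22 u v; have := set21 a b; have := set22 a b.
rewrite {1 2}E -{1 2}E !inE.
by do 4!case/orP=> /eqP ?; subst; auto.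
Qed.

Section Forests.
Variable G : sgraph.
Implicit Types (F T : {set {set G}}) (e : {set G}) (u v w s t a b : G).

Definition erel F : rel G := fun u v => [set u; v] \in F.

Definition joined F u v := connect (erel F) u v.

Lemma joined_sym F : symmetric (joined F).
Proof. by apply: sym_connect_sym => u v; rewrite /erel setUC. Qed.

Lemma joined_trans F : transitive (joined F).
Proof. exact: connect_trans. Qed.

Lemma joined_edge F u v : [set u; v] \in F -> joined F u v.
Proof. by move=> uvF; apply: connect1. Qed.

Lemma joined_sub F F' u v : F \subset F' -> joined F u v -> joined F' u v.
Proof.
by move=> /subsetP FF'; apply: connect_sub => a b /FF' /joined_edge.
Qed.

Lemma joined_add F u v a b : joined ([set u; v] |: F) a b ->
  [|| joined F a b, joined F a u && joined F v b
    | joined F a v && joined F u b].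
Proof.
case/connectP=> p; elim: p a => [|d p IHp] a /=.
  by move=> _ ->; rewrite /joined connect0.
case/andP=> ad /IHp{}IHp /IHp{IHp}.
move: ad; rewrite /erel in_setU1 => /orP[/eqP /set2_eq[] [-> ->]|/joined_edge ad].
- by case/or3P=> [->|/andP[_ ->]|/andP[_ ->]]; rewrite /joined ?connect0 /= ?orbT.
- by case/or3P=> [->|/andP[_ ->]|/andP[_ ->]]; rewrite /joined ?connect0 /= ?orbT.
- by case/or3P=> [/(joined_trans ad)->|/andP[]/(joined_trans ad)-> ->
    |/andP[]/(joined_trans ad)-> ->]; rewrite ?orbT.
Qed.

(* Acyclicity, phrased as: every edge is a bridge. *)
Definition forest F :=
  [forall u, forall v,
     ([set u; v] \in F) ==> ~~ joined (F :\ [set u; v]) u v].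

Lemma forestP F :
  reflect (forall u v, [set u; v] \in F -> ~~ joined (F :\ [set u; v]) u v)
          (forest F).
Proof.
apply: (iffP forallP) => [h u v uvF|h u].
  by have /forallP/(_ v)/implyP := h u; apply.
by apply/forallP=> v; apply/implyP; apply: h.
Qed.

Lemma forest_sub F F' : F \subset F' -> forest F' -> forest F.
Proof.
move=> FF' /forestP h; apply/forestP=> u v uvF.
apply: contra (h u v (subsetP FF' _ uvF)).
by apply: joined_sub; apply: setSD.
Qed.

(** If another edge [ab] were not a bridge after the addition, its detour would use [uv]; replacing
    [uv] by [ab] and the rest of the detour would then join [u] and [v] inside [F]. *)
Lemma forest_add F u v :
  forest F -> ~~ joined F u v -> forest ([set u; v] |: F).
Proof.
move=> /forestP FF uv; apply/forestP=> a b.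
have uvF : [set u; v] \notin F by apply: contra uv => /joined_edge.
case: (eqVneq [set a; b] [set u; v]) => [E _|ne].
  rewrite E setU1K //.
  by case: (set2_eq E) => [[-> ->]|[-> ->]]; rewrite // joined_sym.
rewrite in_setU1 (negPf ne) /= => abF.
have -> : ([set u; v] |: F) :\ [set a; b] = [set u; v] |: (F :\ [set a; b]).
  by apply/setP=> e; rewrite !inE; case: (eqVneq e [set u; v]) => [->|//];
    rewrite eq_sym ne.
have sub a' b' := @joined_sub _ _ a' b' (subsetDl F [set [set a; b]]).
have ab := joined_edge abF.
apply/negP=> /joined_add/or3P[]; first exact/negP/FF.
- case/andP=> /sub au /sub vb; case/negP: uv.
  by rewrite joined_sym; apply: (joined_trans vb);
     rewrite joined_sym in ab; apply: (joined_trans ab).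
- case/andP=> /sub av /sub ub; case/negP: uv.
  by apply: (joined_trans ub); rewrite joined_sym in ab;
     apply: (joined_trans ab).
Qed.

Lemma edgesP u v : ([set u; v] \in edges G) = adj u v.
Proof.
apply/imsetP/idP=> [[[a b]]|uv]; last by exists (u, v); rewrite ?inE.
by rewrite inE /= => ab /set2_eq[] [-> ->]; rewrite // adj_sym.
Qed.

Lemma in_edges F e : F \subset edges G -> e \in F ->
  exists u v, e = [set u; v] /\ adj u v.
Proof.
by move=> /subsetP FE /FE /imsetP[[a b] + ->]; rewrite inE; exists a, b.
Qed.

Lemma acyclic_forest F : F \subset edges G -> acyclic F = forest F.
Proof.
move=> FE; apply/asboolP/forestP => [noc u v uvF|h].
  apply/negP=> /connectP[p pth lastp].
  have uv : u != v.
    apply/eqP=> E; move: uvF => /(subsetP FE).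
    by rewrite edgesP E adj_irrefl.
  case/shortenP: pth lastp => q pth uq _ lastq.
  have := noc (u :: q); rewrite /ucycle uq /= rcons_path -lastq.
  rewrite (_ : path _ u q) /=; last first.
    by apply: sub_path pth => a b; rewrite /erel in_setD1 => /andP[].
  rewrite setUC uvF => /(_ isT).
  (* A closed sequence of length at most 2 means that [u = v] or that the detour is the deleted edge
     itself. *)
  move: pth lastq {uq}; case: q => [|d [|d' q]] //=.
    by move=> _ E; rewrite E eqxx in uv.
  by rewrite andbT /erel in_setD1 => /andP[+ _] E; rewrite -E eqxx.
case=> [|a [|b [|d s]]] //= /andP[] /=.
case/and3P=> abF bd pth.
rewrite !inE !negb_or => /and3P[/and3P[ab ad _] /andP[bd' bs] _].
(* The rest of the cycle leads from [b] back to [a] without [ab]: its first edge goes to [d],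
   distinct from [a], and its later edges miss [b]. *)
case/negP: (h _ _ abF); rewrite joined_sym; apply/connectP.
exists (d :: rcons s a); last by rewrite /= last_rcons.
rewrite /= /erel in_setD1 bd andbT; apply/andP; split.
  apply: contraNneq bd' => /set2_eq[] [_ dE]; first by rewrite dE.
  by rewrite dE eqxx in ad.
apply: (sub_in_path (P := predC1 b)) pth.
  move=> v w. rewrite !inE => vb wb -> /=; rewrite andbT.
  by apply/eqP=> E; have := set22 a b; rewrite -E !inE ![b == _]eq_sym
    (negPf vb) (negPf wb).
by rewrite /= eq_sym bd' all_rcons /= ab; apply/allP=> v vs /=;
  apply: contraNneq bs => <-.
Qed.

Lemma spanning_treeP T : connected_graph G ->
  reflect [/\ T \subset edges G, forest T & forall u v, joined T u v]
          (spanning_tree T).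
Proof.
move=> [_ Gconn]; apply: (iffP maxsetP) => [[/andP[TE]]|[TE Tf Tc]].
  rewrite acyclic_forest // => Tf Tmax; split=> // u v.
  have sub a b : adj a b -> joined T a b.
    move=> ab; apply/negPn/negP=> nab.
    have /Tmax TT : ([set a; b] |: T \subset edges G) && acyclic ([set a; b] |: T).
      have TE' : [set a; b] |: T \subset edges G.
        by rewrite subUset sub1set edgesP ab.
      by rewrite TE' acyclic_forest // forest_add.
    case/negP: nab; apply: joined_edge.
    by rewrite -(TT (subsetUr _ _)) setU11.
  by have := connect_sub sub (Gconn u v).
split=> [|S /andP[SE]]; first by rewrite TE acyclic_forest.
rewrite acyclic_forest // => /forestP Sf TS; apply/eqP; rewrite eqEsubset TS andbT.
apply/subsetP=> e eS; have [u [v [E _]]] := in_edges SE eS; subst e.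
apply/negPn/negP=> uvT; case/negP: (Sf _ _ eS).
by apply: joined_sub (Tc u v); rewrite subsetD1 TS.
Qed.

(* Spanning two-component forests with [s] and [t] in different components. *)
Definition forest2 s t F :=
  [&& F \subset edges G, forest F, ~~ joined F s t
    & [forall w, joined F w s || joined F w t]].

Lemma forest2_cover s t F w : forest2 s t F -> joined F w t = ~~ joined F w s.
Proof.
case/and4P=> _ _ st /forallP/(_ w); case ws: (joined F w s) => //= _.
by apply: contraNF st => wt; rewrite joined_sym in ws; apply: (joined_trans ws).
Qed.

Lemma forest2_swap s t u v F : joined F u s -> joined F v t ->
  forest2 s t F = forest2 u v F.
Proof.
move=> us vt; rewrite /forest2.
have E a b w : joined F a b -> joined F w a = joined F w b.
  by move=> ab; apply/idP/idP => h; apply: (joined_trans h); rewrite // joined_sym.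
have -> : joined F s t = joined F u v.
  by rewrite -(E _ _ _ vt) ![joined F _ v]joined_sym (E _ _ _ us).
by congr [&& _, _, _ & _]; apply: eq_forallb => w; rewrite (E _ _ _ us) (E _ _ _ vt).
Qed.

(** This correspondence between trees through [uv] and two-component forests separating [u] from [v]
    carries all the counting below. *)
Lemma spanning_tree_add F u v : connected_graph G ->
  adj u v -> [set u; v] \notin F ->
  spanning_tree ([set u; v] |: F) = forest2 u v F.
Proof.
move=> Gc uv uvF; apply/(spanning_treeP _ Gc)/idP => [[FE Ff Fc]|].
  apply/and4P; split.
  - by move: FE; rewrite subUset => /andP[].
  - by apply: forest_sub Ff; apply: subsetUr.
  - by move/forestP: Ff => /(_ u v); rewrite setU1K //; apply; rewrite setU11.
  apply/forallP=> w; case/or3P: (joined_add (Fc w u)) => [->//|/andP[->]//|].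
  by case/andP=> ->; rewrite orbT.
case/and4P=> FE Ff nuv /forallP cov; split.
- by rewrite subUset FE sub1set edgesP uv.
- exact: forest_add.
have sub a b := @joined_sub _ _ a b (subsetUr [set [set u; v]] F).
have cu a : joined ([set u; v] |: F) a u.
  case/orP: (cov a) => /sub // av; apply: (joined_trans av).
  by apply: joined_edge; rewrite setUC setU11.
by move=> a b; apply: (joined_trans (cu a)); rewrite joined_sym.
Qed.

(** A path from [w] that met [u] would join [u] to [w]. *)
Lemma joined_avoid F u w t : ~~ joined F u w -> joined F w t ->
  joined (F :\: [set e : {set G} | u \in e]) w t.
Proof.
move=> uw /connectP[p pth ->] {t}; apply/connectP; exists p => //.
elim: p w uw pth => //= a p IHp w uw /andP[wa pth].
rewrite IHp // ?andbT.
  move: wa; rewrite /erel !inE negb_or => wa; rewrite wa andbT; apply/andP; split.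
    by apply: contraNneq uw => ->; rewrite /joined connect0.
  by apply: contraNneq uw => ->; rewrite joined_sym joined_edge.
apply: contra uw => ua; apply: (joined_trans ua).
by rewrite joined_sym joined_edge.
Qed.

(* The neighbours of [u] counted here are the first vertices on the [T]-path
   from [u] to [t]. *)
Lemma tree_branch (K : pzSemiRingType) T u t : connected_graph G -> spanning_tree T ->
  \sum_(v | adj u v)
    (([set u; v] \in T) && joined (T :\ [set u; v]) v t)%:R
    = (u != t)%:R :> K.
Proof.
move=> Gc /(spanning_treeP _ Gc)[TE /forestP Tf Tc].
case: (eqVneq u t) => [<-|ut] /=.
  rewrite big1 // => v _; case: andP => // -[uvT].
  by rewrite joined_sym (negPf (Tf _ _ uvT)).
have [v uvT vt] : exists2 v, [set u; v] \in T & joined (T :\ [set u; v]) v t.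
  case/connectP: (Tc u t) ut => p pth -> {t}.
  case/shortenP: pth => q pth uq _ {p}.
  case: q pth uq => [|v q] /=; first by rewrite eqxx.
  case/andP=> uv pth /andP[uq _] _.
  exists v => //; apply/connectP; exists q => //.
  apply: (sub_in_path (P := predC1 u)) pth.
    move=> a b; rewrite !inE => au bu; rewrite /erel in_setD1 => ->; rewrite andbT.
    by apply/eqP=> E; have := set21 u v; rewrite -E !inE ![u == _]eq_sym
      (negPf au) (negPf bu).
  by apply/allP=> w wq /=; apply: contraNneq uq => <-.
have uv : adj u v by rewrite -edgesP (subsetP TE).
(* Uniqueness: a second such neighbour [v'] is joined to [v] away from [u], so the edge [uv'] starts
   a detour around the bridge [uv]. *)
rewrite (bigD1 v) //= uvT vt big1 ?addr0 // => v' /andP[uv' v'v].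
case: andP => // -[uv'T v't].
have star w : T :\: [set e : {set G} | u \in e] \subset T :\ [set u; w].
  by apply: setDS; rewrite sub1set inE set21.
have h w : [set u; w] \in T -> joined (T :\ [set u; w]) w t ->
    joined (T :\: [set e : {set G} | u \in e]) w t.
  move=> uwT /(joined_avoid (Tf _ _ uwT)); apply: joined_sub.
  by apply: setSD; apply: subsetDl.
have /(joined_sub (star v)) v'v_ : joined (T :\: [set e : {set G} | u \in e]) v' v.
  by apply: (joined_trans (h _ uv'T v't)); rewrite joined_sym; apply: h.
case/negP: (Tf _ _ uvT); apply: joined_trans v'v_; apply: joined_edge.
rewrite !inE uv'T andbT; apply: contraNneq v'v => /set2_eq[] [E1 E2].
  by rewrite E2.
by rewrite E2 -E1.
Qed.

End Forests.

(** * Kirchhoff's theorem and the Laplacian *)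

Section Laplacian.
Variables (R : realType) (G : sgraph).
Implicit Types (c : {set G} -> R) (f g : G -> R) (F T : {set {set G}}).

Definition lap c f u : R := \sum_(v | adj u v) c [set u; v] * (f u - f v).

Definition weight c F : R := \prod_(e in F) c e.

Definition tree_sum c : R := \sum_(T | @spanning_tree G T) weight c T.

(** Divided by [tree_sum], this is the potential of a unit current from [s] to [t], with value 0 at
    [t]. *)
Definition forest_potential c s t u : R :=
  \sum_(F | forest2 s t F) (joined F u s)%:R * weight c F.

(** Total weight of the trees whose path from [s] to [t] traverses [uv] from [u] to [v]. *)
Definition tree_flow c s t u v : R :=
  \sum_(T | @spanning_tree G T)
    [&& [set u; v] \in T, joined (T :\ [set u; v]) u s
      & joined (T :\ [set u; v]) v t]%:R * weight c T.

Lemma tree_flow_forest c s t u v : connected_graph G -> adj u v ->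
  tree_flow c s t u v =
  c [set u; v] *
    \sum_(F | forest2 s t F) (joined F u s && joined F v t)%:R * weight c F.
Proof.
move=> Gc uv; rewrite /tree_flow.
rewrite (eq_bigr (fun T => if [&& [set u; v] \in T, joined (T :\ [set u; v]) u s
      & joined (T :\ [set u; v]) v t] then weight c T else 0)); last first.
  by move=> T _; case: ifP; rewrite ?mul1r ?mul0r.
rewrite -big_mkcondr.
rewrite [in RHS](eq_bigr (fun F => if joined F u s && joined F v t
   then weight c F else 0)); last first.
  by move=> T _; case: ifP; rewrite ?mul1r ?mul0r.
rewrite -big_mkcondr big_distrr /=.
rewrite (reindex_onto (fun F => [set u; v] |: F) (fun T => T :\ [set u; v])) /=;
  last by move=> T /and3P[_ uvT _]; rewrite setD1K.
apply: eq_big => [F|F /andP[_ /eqP FE]]; last first.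
  by rewrite /weight big_setU1 // -FE !inE eqxx.
rewrite setU11 /=.
(* Such an [F] counts on neither side: it is not a tree with [uv] deleted, and [uv] would join [s]
   to [t] in it. *)
case uvF: ([set u; v] \in F).
  have /negPf -> : (([set u; v] |: F) :\ [set u; v]) != F.
    by apply/eqP=> E; move: uvF; rewrite -E !inE eqxx.
  rewrite andbF; apply/esym/negP => /and3P[/and4P[_ _ /negP st _] us vt]; apply: st.
  apply: joined_trans vt; rewrite joined_sym in us; apply: (joined_trans us).
  exact: joined_edge.
rewrite setU1K ?uvF // eqxx andbT.
case us: (joined F u s) => /=; last by rewrite !andbF.
case vt: (joined F v t) => /=; last by rewrite !andbF.
by rewrite !andbT spanning_tree_add ?uvF // (forest2_swap us vt).
Qed.

(** Ohm's law, forest by forest: [F] contributes to the drop only if it separates [u] from [v], with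
    a sign telling which of them lies with [s]. *)
Lemma forest_potential_drop c s t u v : connected_graph G -> adj u v ->
  c [set u; v] * (forest_potential c s t u - forest_potential c s t v) =
  tree_flow c s t u v - tree_flow c s t v u.
Proof.
move=> Gc uv; have vu : adj v u by rewrite adj_sym.
rewrite !tree_flow_forest // [[set v; u]]setUC -mulrBr; congr (_ * _).
rewrite /forest_potential -!sumrB; apply: eq_bigr => F sF.
rewrite -!mulrBl !(forest2_cover _ sF); congr (_ * _).
by case: (joined F u s); case: (joined F v s); rewrite /= ?subrr ?subr0.
Qed.

(* Kirchhoff: the net flow out of [u] along a tree is that of its [s]-[t] path. *)
Lemma lap_forest_potential c s t u : connected_graph G ->
  lap c (forest_potential c s t) u = tree_sum c * ((u == s)%:R - (u == t)%:R).
Proof.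
move=> Gc; rewrite /lap.
under eq_bigr => v uv do rewrite forest_potential_drop // /tree_flow -sumrB.
rewrite exchange_big mulr_suml /=; apply: eq_bigr => T sT.
have -> : (u == s)%:R - (u == t)%:R = (u != t)%:R - (u != s)%:R :> R.
  by case: eqP; case: eqP => _ _ /=; rewrite ?subr0 ?sub0r ?subrr ?addr0.
rewrite -!(tree_branch R _ _ Gc sT) -sumrB mulr_sumr; apply: eq_bigr => v uv.
rewrite [[set v; u]]setUC -mulrBl mulrC; congr (_ * _).
case uvT: ([set u; v] \in T) => //=.
(* Without [uv], each of [s] and [t] lies with exactly one of [u] and [v], so the net flow along
   [uv] depends only on which of them lie with [v]. *)
have f2 : forest2 u v (T :\ [set u; v]).
  by rewrite -spanning_tree_add ?setD1K // !inE eqxx.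
rewrite ![joined _ u _]joined_sym ![joined _ v _]joined_sym !(forest2_cover _ f2).
by case: joined; case: joined; rewrite /= ?subrr ?subr0.
Qed.

(** In a tree containing [st], the path from [s] to [t] is this edge, so no tree flows backwards
    along it. *)
Lemma forest_potential_edge c s t : connected_graph G -> adj s t ->
  c [set s; t] * (forest_potential c s t s - forest_potential c s t t) =
  \sum_(T | spanning_tree T && ([set s; t] \in T)) weight c T.
Proof.
move=> Gc st; rewrite forest_potential_drop // /tree_flow -sumrB.
rewrite big_mkcondr; apply: eq_bigr => T sT.
rewrite [[set t; s]]setUC; case: ifP => stT /=; last by rewrite mul0r subrr.
have f2 : forest2 s t (T :\ [set s; t]).
  by rewrite -spanning_tree_add ?setD1K // !inE eqxx.
have /and4P[_ _ nst _] := f2.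
by rewrite (negPf nst) andbF mul0r subr0 /joined !connect0 mul1r.
Qed.

(** * The Dirichlet form and uniqueness of potentials *)

Lemma sum_adj_swap (h : G -> G -> R) :
  \sum_(u : G) \sum_(v | adj u v) h u v = \sum_(u : G) \sum_(v | adj u v) h v u.
Proof.
rewrite (exchange_big_dep predT) //=; apply: eq_bigr => u _.
by apply: eq_bigl => v; rewrite adj_sym.
Qed.

(** Summation by parts; the factor 2 arises because each edge is summed from both ends. *)
Lemma dirichlet_form c f g :
  2 * (\sum_u g u * lap c f u) =
  \sum_(u : G) \sum_(v | adj u v) c [set u; v] * ((g u - g v) * (f u - f v)).
Proof.
rewrite /lap; under eq_bigr do rewrite big_distrr /=.
rewrite mulr_natl mulr2n [X in _ + X]sum_adj_swap -big_split /=.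
apply: eq_bigr => u _; rewrite -big_split /=; apply: eq_bigr => v _.
by rewrite [[set v; u]]setUC; ring.
Qed.

Lemma lap_self_adjoint c f g :
  \sum_u g u * lap c f u = \sum_u f u * lap c g u.
Proof.
apply: (mulfI (_ : 2 != 0)); first by rewrite pnatr_eq0.
rewrite !dirichlet_form; apply: eq_bigr => u _; apply: eq_bigr => v _.
by rewrite [(g u - g v) * _]mulrC.
Qed.

Lemma sum_lap c f : \sum_u lap c f u = 0.
Proof.
transitivity (\sum_u 1 * lap c f u); first by apply: eq_bigr => u; rewrite mul1r.
rewrite lap_self_adjoint big1 // => u _.
by rewrite /lap big1 ?mulr0 // => v _; rewrite subrr mulr0.
Qed.

(** Stated for two functions because it serves twice: with [f = g] for uniqueness of potentials, and
    with [g] an indicator for connectedness of the inversion. *)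
Lemma dirichlet_form_eq0 c f g : edge_weights c ->
  (forall u v, adj u v -> 0 <= (g u - g v) * (f u - f v)) ->
  \sum_u g u * lap c f u = 0 ->
  forall u v, adj u v -> (g u - g v) * (f u - f v) = 0.
Proof.
move=> cw ge0 E u v uv.
have c0 a b : adj a b -> 0 < c [set a; b] by move=> ab; apply: cw; rewrite edgesP.
have t0 a b : adj a b -> 0 <= c [set a; b] * ((g a - g b) * (f a - f b)).
  by move=> ab; apply: mulr_ge0 (ltW (c0 _ _ ab)) (ge0 _ _ ab).
move: (dirichlet_form c f g); rewrite E mulr0 => /esym/psumr_eq0P Z.
have /psumr_eq0P Zu := Z (fun a _ => sumr_ge0 _ (t0 a)) u isT.
have /eqP := Zu (t0 u) v uv.
by rewrite mulf_eq0 gt_eqF ?c0 //= => /eqP.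
Qed.

Lemma energy_eq0 c f : connected_graph G -> edge_weights c ->
  \sum_u f u * lap c f u = 0 -> forall u v, f u = f v.
Proof.
move=> [_ Gc] cw E u v.
have h a b : adj a b -> f a = f b.
  move=> ab; have /eqP := dirichlet_form_eq0 cw (fun u v _ => sqr_ge0 (f u - f v)) E ab.
  by rewrite mulf_eq0 orbb subr_eq0 => /eqP.
case/connectP: (Gc u v) => p pth -> {v}.
by elim: p u pth => //= a p IHp u /andP[/h -> /IHp].
Qed.

Lemma lapB c f g u : lap c (fun v => f v - g v) u = lap c f u - lap c g u.
Proof. by rewrite /lap -sumrB; apply: eq_bigr => v _; ring. Qed.

Lemma lap_affine c k d f u : lap c (fun v => k * (f v - d)) u = k * lap c f u.
Proof. by rewrite /lap mulr_sumr; apply: eq_bigr => v _; ring. Qed.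

Lemma tree_sum_gt0 c : edge_weights c -> 0 < tree_sum c.
Proof.
move=> cw; have w0 T : @spanning_tree G T -> 0 < weight c T.
  move=> /maxsetP[/andP[TE _] _]; apply: prodr_gt0 => e eT.
  by apply: cw; apply: (subsetP TE).
have [T sT _] : {T | @spanning_tree G T & set0 \subset T}.
  apply: maxset_exists; rewrite sub0set acyclic_forest ?sub0set //.
  by apply/forestP=> u v; rewrite inE.
rewrite /tree_sum (bigD1 T) //=; apply: ltr_pwDl; first exact: w0.
by apply: sumr_ge0 => T' /andP[/w0/ltW].
Qed.

Lemma resistance_potential c f s t : connected_graph G -> edge_weights c ->
  adj s t -> (forall u, lap c f u = (u == s)%:R - (u == t)%:R) ->
  resistance c [set s; t] = c [set s; t] * (f s - f t).
Proof.
move=> Gc cw st Lf; have T0 := tree_sum_gt0 cw.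
rewrite /resistance -(forest_potential_edge _ Gc st).
set p := forest_potential c s t.
(* [h] is harmonic everywhere, hence constant; the [- 0] gives the shape of [lap_affine]. *)
pose h v := p v - tree_sum c * (f v - 0).
have hst : h s = h t.
  apply: (energy_eq0 Gc cw); apply: big1 => u _.
  by rewrite lapB lap_affine lap_forest_potential // Lf subrr mulr0.
have -> : p s - p t = tree_sum c * (f s - f t) by move: hst; rewrite /h; lra.
by rewrite -/(tree_sum c); field; apply: lt0r_neq0.
Qed.

(** [k s] is the potential of a unit current from [s] to [x], grounded at [x]; for [s = x] the
    current is zero. *)
Definition green c x (k : G -> G -> R) : Prop :=
  forall s, k s x = 0 /\ forall u, lap c (k s) u = (u == s)%:R - (u == x)%:R.

Lemma green_exists c x : connected_graph G -> edge_weights c ->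
  exists k, green c x k.
Proof.
move=> Gc cw; have T0 := tree_sum_gt0 cw.
exists (fun s u => (tree_sum c)^-1 *
  (forest_potential c s x u - forest_potential c s x x)) => s.
split=> [|u]; first by rewrite subrr mulr0.
by rewrite lap_affine lap_forest_potential // mulKf // lt0r_neq0.
Qed.

End Laplacian.

(** * The Green function, resistance and curvature *)

Section Green.
Variables (R : realType) (G : sgraph) (c : {set G} -> R) (x : G).
Hypotheses (Gc : connected_graph G) (cw : edge_weights c).
Variable (g : G -> G -> R).
Hypothesis gG : green c x g.

Let gx s : g s x = 0 := (gG s).1.
Let gL s := (gG s).2.

Lemma green_pairing s f : \sum_u f u * lap c (g s) u = f s - f x.
Proof.
under eq_bigr do rewrite gL mulrBr.
have h v : \sum_u f u * (u == v)%:R = f v.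
  rewrite (bigD1 v) //= eqxx mulr1 big1 ?addr0 // => u /negPf ->.
  by rewrite mulr0.
by rewrite sumrB !h.
Qed.

Lemma green_sym s t : g s t = g t s.
Proof.
have := lap_self_adjoint c (g s) (g t); rewrite !green_pairing !gx !subr0.
by move=> ->.
Qed.

Lemma green_base t : g x t = 0. Proof. by rewrite green_sym gx. Qed.

(** [g s s] is the energy of [g s]; if it vanished, [g s] would be constant and carry no current out
    of [s]. *)
Lemma green_diag_gt0 s : s != x -> 0 < g s s.
Proof.
move=> sx; rewrite lt_def andbC.
have E : \sum_u g s u * lap c (g s) u = g s s by rewrite green_pairing gx subr0.
apply/andP; split.
  have := dirichlet_form c (g s) (g s); rewrite E => D.
  rewrite -(pmulr_rge0 _ (ltr0n _ 2)) D; apply: sumr_ge0 => u _.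
  apply: sumr_ge0 => v uv; apply: mulr_ge0; last exact: sqr_ge0.
  by apply/ltW/cw; rewrite edgesP.
apply/eqP=> g0; rewrite g0 in E.
have h := energy_eq0 Gc cw E; have := gL s s.
rewrite eqxx (negPf sx) subr0 /lap big1; last first.
  by move=> v _; rewrite (h s v) subrr mulr0.
by move/eqP; rewrite eq_sym oner_eq0.
Qed.

Lemma resistance_green s t : adj s t ->
  resistance c [set s; t] = c [set s; t] * (g s s + g t t - 2 * g s t).
Proof.
move=> st; rewrite (resistance_potential (f := fun u => g s u - g t u) Gc cw st).
  by rewrite (green_sym t s); ring.
by move=> u; rewrite lapB !gL; ring.
Qed.

(** Summing [resistance_green] around [u] gives twice the Laplacian of [g u] minus that of the
    diagonal, and the former is known at [u]. *)
Lemma curvature_lap u :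
  2 * curvature c u = lap c (fun v => g v v) u + 2 * (u == x)%:R.
Proof.
have := gL u u; rewrite eqxx mulr1n => E.
rewrite /curvature mulrBr mulVKf ?pnatr_eq0 //.
have -> : \sum_(v | adj v u) resistance c [set v; u] =
    2 * lap c (g u) u - lap c (fun v => g v v) u.
  rewrite /lap mulr_sumr -sumrB (eq_bigl (adj u)); last by move=> v; rewrite adj_sym.
  apply: eq_bigr => v uv; rewrite setUC resistance_green //; ring.
by rewrite E; case: (u == x); ring.
Qed.

End Green.

(** * Circle inversion *)

Lemma sum_option (V : nmodType) (T : finType) (P : pred (option T))
    (F : option T -> V) :
  \sum_(b | P b) F b =
  (if P None then F None else 0) + \sum_(v | P (Some v)) F (Some v).
Proof.
rewrite big_mkcond (bigD1 None) //=; congr (_ + _).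
rewrite (reindex_omap Some id) /=; last by case.
rewrite [RHS]big_mkcond; apply: eq_bigl => v.
by rewrite eqxx.
Qed.

Section Inversion.
Variables (R : realType) (G : sgraph) (c : {set G} -> R) (x : G).
Hypotheses (Gc : connected_graph G) (cw : edge_weights c).
Hypothesis c_curv : forall v : G, 0 <= curvature c v.
Variable (g : G -> G -> R).
Hypothesis gG : green c x g.

Let H := cinv x c.

Let gx s : g s x = 0 := (gG s).1.
Let a0 s (sx : s != x) : 0 < g s s := green_diag_gt0 Gc cw gG sx.

(* With [g s s] the squared length of [s - x] in the simplex realizing the
   effective resistances, these weights realize the simplex obtained by
   inverting in a sphere centred at [x]. *)
Definition inv_weight (a b : H) : R :=
  match a, b with
  | Some u, Some v => c [set val u; val v] * g (val u) (val u) * g (val v) (val v)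
  | None, Some u | Some u, None => 2 * curvature c (val u) * g (val u) (val u)
  | None, None => 0
  end.

Lemma inv_weight_sym a b : inv_weight a b = inv_weight b a.
Proof. by case: a b => [u|] [v|] //=; rewrite setUC; ring. Qed.

(** Either ordering of the endpoints may be picked, since [inv_weight] is symmetric. *)
Definition inv_weights (e : {set H}) : R :=
  if [pick p : H * H | e == [set p.1; p.2]] is Some p then inv_weight p.1 p.2
  else 0.

Lemma inv_weightsE (a b : H) : inv_weights [set a; b] = inv_weight a b.
Proof.
rewrite /inv_weights; case: pickP => [[a' b'] /eqP /set2_eq|/(_ (a, b))].
  by case=> [[-> ->]|[-> ->]] //=; rewrite inv_weight_sym.
by rewrite eqxx.
Qed.

Lemma inv_edge_weights : edge_weights inv_weights.
Proof.
move=> e eH; have [a [b [-> ab]]] := in_edges (subxx _) eH.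
rewrite inv_weightsE; case: a b ab {e eH} => [u|] [v|] //= uv.
- rewrite !mulr_gt0 ?a0 ?(valP u) ?(valP v) //; apply: cw.
  by rewrite edgesP.
- by rewrite !mulr_gt0 ?a0 ?(valP u).
- by rewrite !mulr_gt0 ?a0 ?(valP v).
Qed.

Lemma sum_cinv_adj (a : H) (F : H -> R) :
  \sum_(b : H | adj a b) F b =
  (if cinv_adj c a None then F None else 0) +
  \sum_(v : {y : G | y != x} | cinv_adj c a (Some v)) F (Some v).
Proof. exact: (@sum_option _ _ (cinv_adj c a)). Qed.

Lemma sum_neq (P : pred G) (F : G -> R) :
  \sum_(v | P v) F v =
  (if P x then F x else 0) + \sum_(v : {y : G | y != x} | P (val v)) F (val v).
Proof.
rewrite big_mkcond (bigD1 x) //= -(big_sub_cond [pred y | y != x]) -big_mkcondr.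
by congr (_ + _); apply: eq_bigl.
Qed.

Lemma curvature_green u : u != x ->
  2 * curvature c u = lap c (fun v => g v v) u.
Proof. by move=> /negPf ux; rewrite (curvature_lap Gc cw gG) ux mulr0 addr0. Qed.

(** Thus the formulas for a new edge give 0 exactly where that edge is absent. *)
Lemma curvature_eq0 u : (0 < curvature c u) = false -> curvature c u = 0.
Proof.
by move=> pu; apply/eqP; have := c_curv u; rewrite le_eqVlt pu orbF eq_sym.
Qed.

(** If [g] is the Gram matrix of vectors based at [x], this is the Gram matrix of their images under
    inversion in the unit sphere. *)
Definition inv_green (a b : H) : R :=
  match a, b with
  | Some u, Some v => g (val u) (val v) / (g (val u) (val u) * g (val v) (val v))
  | _, _ => 0
  end.

Lemma lap_inv_green (u v : {y : G | y != x}) :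
  lap inv_weights (inv_green (Some u)) (Some v) = (v == u)%:R.
Proof.
rewrite /lap sum_cinv_adj /=; set i := val u; set j := val v.
have ai := lt0r_neq0 (a0 (valP u)); have aj := lt0r_neq0 (a0 (valP v)).
have Hi : lap c (g i) j = (j == i)%:R by rewrite (gG i).2 (negPf (valP v)) subr0.
have Hj := curvature_green (valP v).
rewrite -/i -/j in ai aj Hj.
transitivity ((g i j * (2 * curvature c j) +
   \sum_(w : {y | y != x} | adj j (val w))
     c [set j; val w] * (g i j * g (val w) (val w) - g j j * g i (val w))) / g i i).
  rewrite mulrDl big_distrl /=; congr (_ + _); last first.
    apply: eq_bigr => w _; rewrite inv_weightsE /= -/i -/j.
    by have aw := lt0r_neq0 (a0 (valP w)); field; rewrite ai aj aw.
  rewrite inv_weightsE /= subr0 -/i -/j; case: ifP => pj.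
    by field; rewrite ai aj.
  by rewrite (curvature_eq0 pj) !mulr0 mul0r.
(* The second term on the right cancels the contribution of the new edge, since [2 * curvature c j]
   is the Laplacian of the diagonal at [j]. *)
suff -> : \sum_(w : {y | y != x} | adj j (val w))
     c [set j; val w] * (g i j * g (val w) (val w) - g j j * g i (val w)) =
   g j j * lap c (g i) j - g i j * lap c (fun v => g v v) j.
  rewrite Hj Hi addrC subrK -val_eqE /= -/i -/j; case: (eqVneq j i) => [->|_] /=.
    by rewrite mulr1 divff.
  by rewrite mulr0 mul0r.
transitivity (\sum_(w | adj j w)
     c [set j; w] * (g i j * g w w - g j j * g i w)).
  (* The term at [w = x] vanishes because [g] is grounded there. *)
  by rewrite sum_neq !gx !mulr0 subrr mulr0 if_same add0r.
rewrite /lap !mulr_sumr -sumrB; apply: eq_bigr => w _; ring.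
Qed.

Lemma green_inv : green inv_weights (None : H) inv_green.
Proof.
move=> [u|]; split=> //; last first.
  by move=> v; rewrite subrr /lap big1 // => w _; rewrite subrr mulr0.
have E v : lap inv_weights (inv_green (Some u)) (Some v) =
    ((Some v : H) == Some u)%:R - ((Some v : H) == None)%:R.
  by rewrite lap_inv_green subr0.
move=> [v|]; first exact: E.
(* The value at the new vertex follows since a Laplacian sums to 0. *)
have := sum_lap inv_weights (inv_green (Some u)).
rewrite (@sum_option _ {y | y != x} predT) /=.
under eq_bigr do rewrite lap_inv_green.
rewrite (bigD1 u) //= eqxx big1 ?addr0; last by move=> v /negPf ->.
by move/eqP; rewrite addr_eq0 => /eqP ->; rewrite sub0r.
Qed.

(** * Connectedness of the inversion *)

Lemma inv_connected : connected_graph H.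
Proof.
split; first by apply/card_gt0P; exists None.
(* The old vertices not joined to the new one, as a predicate on all of [G] that is false at [x]. *)
pose lost (u : G) :=
  if (insub u : option {y | y != x}) is Some v then
    ~~ connect (@adj H) None (Some v)
  else false.
have lostE (v : {y | y != x}) : lost (val v) = ~~ connect (@adj H) None (Some v).
  by rewrite /lost valK.
have lostE' u (ux : u != x) : lost u = ~~ connect (@adj H) None (Some (Sub u ux)).
    by rewrite -lostE SubK.
have lostx : lost x = false by rewrite /lost insubF ?eqxx.
have lost_neq u : lost u -> u != x by apply: contraTneq => ->; rewrite lostx.
have symH : connect_sym (@adj H) by exact/sym_connect_sym/adj_sym.
have lost_step u v : adj u v -> lost u -> ~~ lost v -> v = x.
  move=> uv lu lv; apply/eqP; apply: contraNT lv => vx.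
  have ux := lost_neq _ lu.
  move: lu; rewrite (lostE' _ ux) (lostE' _ vx).
  apply: contra => /connect_trans; apply; apply: connect1.
  by rewrite /= adj_sym.
have E : \sum_u (lost u)%:R * lap c (fun v => g v v) u = 0.
  apply: big1 => u _; case lu: (lost u); last by rewrite mul0r.
  have ux := lost_neq _ lu; rewrite -curvature_green // curvature_eq0 ?mulr0 //.
  apply: contraTF lu => pu; rewrite (lostE' _ ux) negbK.
  exact: connect1.
(* An edge leaving the lost set ends at [x], where the diagonal of [g] drops to 0 from a positive
   value. *)
have ge0 u v : adj u v -> 0 <= ((lost u)%:R - (lost v)%:R) * (g u u - g v v).
  move=> uv; case lu: (lost u); case lv: (lost v); rewrite /= ?subrr ?mul0r //.
    rewrite (lost_step _ _ uv lu) ?lv // gx !subr0 mul1r ltW // a0 //.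
    exact: lost_neq.
  rewrite adj_sym in uv.
  rewrite (lost_step _ _ uv lv) ?lu // gx !sub0r mulrNN mul1r ltW // a0 //.
  exact: lost_neq.
have lost_const u v : adj u v -> lost u -> lost v.
  move=> uv lu; apply/negPn/negP => lv.
  have := dirichlet_form_eq0 cw ge0 E uv.
  rewrite lu (negPf lv) (lost_step _ _ uv lu lv) gx !subr0 mul1r => /eqP.
  by rewrite gt_eqF // a0 // lost_neq.
have nolost u : ~~ lost u.
  apply: contraFN lostx; case/connectP: (Gc.2 u x) => p pth ->.
  by elim: p u pth => //= a p IHp u /andP[/lost_const h /IHp k] /h.
have conn (b : H) : connect (@adj H) None b.
  by case: b => [v|//]; have := nolost (val v); rewrite lostE negbK.
by move=> a b; apply: (connect_trans (y := None)); rewrite // symH.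
Qed.

(** * Resistances and curvatures of the inversion *)

Lemma inv_resistance (u v : {y | y != x}) : adj (val u) (val v) ->
  resistance inv_weights [set (Some u : H); Some v] = resistance c [set val u; val v].
Proof.
move=> uv; rewrite (resistance_green inv_connected inv_edge_weights green_inv) //.
rewrite inv_weightsE (resistance_green Gc cw gG) //=.
by field; rewrite !lt0r_neq0 ?a0 ?(valP u) ?(valP v).
Qed.

Lemma inv_resistance_None (u : {y | y != x}) : 0 < curvature c (val u) ->
  resistance inv_weights [set (None : H); Some u] = 2 * curvature c (val u).
Proof.
move=> pu; rewrite (resistance_green inv_connected inv_edge_weights green_inv) //.
rewrite inv_weightsE /=.
by field; rewrite !lt0r_neq0 ?a0 ?(valP u).
Qed.

(** The resistances at [u] in [G] sum to [2 - 2 * curvature c u]; losing the edge to [x] and gaining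
    a new one of resistance [2 * curvature c u] leaves half the resistance of [xu]. *)
Lemma inv_curvature (u : {y | y != x}) :
  curvature inv_weights (Some u : H) =
  if adj x (val u) then 2^-1 * (c [set x; val u] * g (val u) (val u)) else 0.
Proof.
have -> : curvature inv_weights (Some u : H) =
    1 - 2^-1 * (2 * curvature c (val u) +
      \sum_(v : {y | y != x} | adj (val u) (val v)) resistance c [set val v; val u]).
  rewrite {1}/curvature; congr (1 - 2^-1 * _).
  rewrite (eq_bigl (fun b : H => @adj H (Some u) b)); last by move=> b; rewrite adj_sym.
  rewrite sum_cinv_adj /=; congr (_ + _).
    case: ifP => pu; first exact: inv_resistance_None.
    by rewrite (curvature_eq0 pu) mulr0.
  by apply: eq_bigr => v uv; rewrite inv_resistance // adj_sym.
have : curvature c (val u) = 1 - 2^-1 *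
    ((if adj x (val u) then c [set x; val u] * g (val u) (val u) else 0) +
      \sum_(v : {y | y != x} | adj (val u) (val v)) resistance c [set val v; val u]).
  rewrite /curvature sum_neq; congr (1 - 2^-1 * (_ + _)).
    case: ifP => // xu; rewrite (resistance_green Gc cw gG) // gx.
    by rewrite (green_base gG) mulr0 subr0 add0r.
  by apply: eq_bigl => v; rewrite adj_sym.
by case: ifP => _; lra.
Qed.

Lemma inv_curvature_None : curvature inv_weights (None : H) = curvature c x.
Proof.
have -> : curvature inv_weights (None : H) =
    1 - \sum_(v : {y | y != x}) curvature c (val v).
  rewrite {1}/curvature; congr (1 - _).
  rewrite (eq_bigl (fun b : H => @adj H None b)); last by move=> b; rewrite adj_sym.
  rewrite sum_cinv_adj /= add0r mulr_sumr big_mkcond; apply: eq_bigr => v _.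
  case: ifP => pv; first by rewrite setUC inv_resistance_None // mulKf ?pnatr_eq0.
  by rewrite (curvature_eq0 pv).
(* Total curvature is 1: in [curvature_lap] the Laplacian sums to 0 and only the term at [x]
   survives. *)
have : \sum_v 2 * curvature c v = 2.
  under eq_bigr do rewrite (curvature_lap Gc cw gG).
  rewrite big_split /= sum_lap add0r (bigD1 x) //= eqxx mulr1 big1 ?addr0 //.
  by move=> v /negPf ->; rewrite mulr0.
rewrite (@sum_neq predT) -mulr_sumr /=; lra.
Qed.

End Inversion.

Theorem proposition6p18 (R : realType) (G : sgraph) (x : G) (c : {set G} -> R)
    (G_RN : resistance_nonnegative R G)
    (c_weights : edge_weights c)
    (c_curv : forall v : G, 0 <= curvature c v) :
  resistance_nonnegative R (cinv x c) /\
  (0 < curvature c x -> (forall y : G, y != x -> adj x y) ->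
   resistance_positive R (cinv x c)).
Proof.
have [Gc _] := G_RN; have [g gG] := green_exists x Gc c_weights.
have w0 (u : {y | y != x}) : adj x (val u) ->
    0 < 2^-1 * (c [set x; val u] * g (val u) (val u)).
  move=> xu; rewrite !mulr_gt0 ?invr_gt0 ?ltr0n //.
    by apply: c_weights; rewrite edgesP.
  by rewrite (green_diag_gt0 Gc c_weights gG) // (valP u).
have Hc := inv_connected Gc c_weights c_curv gG.
have Hw := inv_edge_weights Gc c_weights gG.
split=> [|px xall]; (split; first exact: Hc);
  exists (inv_weights (c := c) (x := x) g); split=> // -[u|].
- rewrite inv_curvature //; case: ifP => // xu; exact/ltW/w0.
- by rewrite inv_curvature_None.
- by rewrite inv_curvature // xall ?(valP u) // w0 // xall // (valP u).
- by rewrite inv_curvature_None.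
Qed.
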